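(* Let $A\in\mathbb{R}^{m\times N}$ with $m<N$, let $q\in(1,\infty]$, and let $\mathbf{x}\in\mathbb{R}^N$ satisfy $\lVert\mathbf{x}\rVert_0=k<2^{\frac{q}{1-q}}\Delta_q(A)$. For $p>0$ and $\sigma>0$, let $\hat{\mathbf{x}}=\hat{\mathbf{x}}_{p,\sigma}$ be a solution of $$\min_{\mathbf{z}\in\mathbb{R}^N} J_{p,\sigma}(\mathbf{z})\quad\text{subject to}\quad A\mathbf{z}=A\mathbf{x}.$$ Then $\hat{\mathbf{x}}_{p,\sigma}$ approaches $\mathbf{x}$, which is the unique solution of $\min_{\mathbf{z}\in\mathbb{R}^N}\lVert\mathbf{z}\rVert_0$ subject to $A\mathbf{z}=A\mathbf{x}$, as $\sigma\,\mathrm{erf}_p^{-1}(1-\frac1N)$ approaches $0$. That is, for every $\epsilon>0$ there is $\delta>0$ such that for all $p>0$, $\sigma>0$ with $\sigma\,\mathrm{erf}_p^{-1}(1-\frac1N)<\delta$, every such solution $\hat{\mathbf{x}}_{p,\sigma}$ satisfies $\lVert\hat{\mathbf{x}}_{p,\sigma}-\mathbf{x}\rVert_q<\epsilon$. In particular, when $p>0$ is fixed, $\hat{\mathbf{x}}_{p,\sigma}\to\mathbf{x}$ as $\sigma\to0^+$.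
   Context: For $p>0$, the generalized error function is $\mathrm{erf}_p(x)=\frac{p}{\Gamma(1/p)}\int_0^x e^{-t^p}\,dt$ for $x\ge 0$; it is strictly increasing from $[0,\infty)$ onto $[0,1)$, and $\mathrm{erf}_p^{-1}:[0,1)\to[0,\infty)$ is its inverse. For $p>0$, $\sigma>0$ and $\mathbf{x}\in\mathbb{R}^N$, define $J_{p,\sigma}(\mathbf{x})=\sum_{j=1}^N \Phi_{p,\sigma}(|x_j|)$, where $\Phi_{p,\sigma}(x)=\int_0^x e^{-(\tau/\sigma)^p}\,d\tau=\frac{\sigma\Gamma(1/p)}{p}\mathrm{erf}_p(x/\sigma)$ for $x\ge 0$. $\lVert\mathbf{x}\rVert_0$ is the number of nonzero entries of $\mathbf{x}$, and $\mathrm{Ker}(A)=\{\mathbf{v}\in\mathbb{R}^N:A\mathbf{v}=\mathbf{0}\}$. For $q\in(1,\infty]$, the $\Delta_q$-spherical section constant of $A$ is $$\Delta_q(A)=\inf_{\mathbf{v}\in\mathrm{Ker}(A)\setminus\{\mathbf{0}\}}\left(\frac{\lVert\mathbf{v}\rVert_1}{\lVert\mathbf{v}\rVert_q}\right)^{\frac{q}{q-1}}.$$ For $q=\infty$, the conventions are $\frac{q}{q-1}=1$ and $\frac{q}{1-q}=-1$. *)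

(* Defs.v *)
From HB Require Import structures.
From mathcomp Require Import all_boot all_order all_algebra.
From mathcomp Require Import all_classical all_reals all_analysis.
Set Implicit Arguments.
Unset Strict Implicit.
Unset Printing Implicit Defensive.
Import Order.TTheory GRing.Theory Num.Theory.
Import numFieldNormedType.Exports.
Local Open Scope classical_set_scope.
Local Open Scope ring_scope.

Section GeneralizedErf.
Context {R : realType}.
Implicit Types p s x y z : R.

Definition Gamma z : R :=
  (\int[@lebesgue_measure R]_(t in `]0%R, +oo[) (t `^ (z - 1) * expR (- t)))%R.

(* Meaningful for 0 <= x; the integral is 0 when x < 0. *)
Definition erfp p x : R :=
  p / Gamma p^-1 *
  (\int[@lebesgue_measure R]_(t in `[0%R, x]) expR (- (t `^ p)))%R.

(* The inverse of the restriction of erfp p to [0, +oo[, a junk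
   value outside the image of that interval. *)
Definition erfp_inv p : R -> R := 'pinv_(fun=> 0) `[0, +oo[ (erfp p).

Definition Phi p s x : R :=
  (\int[@lebesgue_measure R]_(t in `[0%R, x]) expR (- ((t / s) `^ p)))%R.

Definition J p s (N : nat) (z : 'cV[R]_N) : R := \sum_(j < N) Phi p s `|z j 0|.

End GeneralizedErf.

Section Sparsity.
Context {R : realType}.

Definition l0norm (N : nat) (v : 'cV[R]_N) : nat := #|[set j | v j 0 != 0]%SET|.

(* Only used for 1 <= q <= +oo. *)
Definition lqnorm (q : \bar R) (N : nat) (v : 'cV[R]_N) : R :=
  match q with
  | r%:E => (\sum_(j < N) `|v j 0| `^ r) `^ r^-1
  | +oo%E => \big[Num.max/0]_(j < N) `|v j 0|
  | -oo%E => 0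
  end.

(* q / (q - 1) and q / (1 - q) with their conventional values at q = +oo. *)
Definition exp_qm1 (q : \bar R) : R :=
  match q with
  | r%:E => r / (r - 1)
  | +oo%E => 1
  | -oo%E => 0
  end.

Definition exp_1mq (q : \bar R) : R :=
  match q with
  | r%:E => r / (1 - r)
  | +oo%E => - 1
  | -oo%E => 0
  end.

Definition Ker (m N : nat) (A : 'M[R]_(m, N)) : set 'cV[R]_N :=
  [set v | A *m v = 0].

(* A real infimum: the set below is bounded below by 0, and it is nonempty as
   soon as Ker A is nontrivial, in particular when m < N. *)
Definition sph_const (q : \bar R) (m N : nat) (A : 'M[R]_(m, N)) : R :=
  inf [set (lqnorm 1%:E v / lqnorm q v) `^ exp_qm1 q | v in Ker A `\ 0].

Definition is_minimizer (d : Order.disp_t) (T : porderType d) (m N : nat)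
    (A : 'M[R]_(m, N)) (b : 'cV[R]_m) (F : 'cV[R]_N -> T) (z : 'cV[R]_N) : Prop :=
  A *m z = b /\ forall w : 'cV[R]_N, A *m w = b -> (F z <= F w)%O.

End Sparsity.

(* Main.v *)
Require Import Defs.
From HB Require Import structures.
From mathcomp Require Import all_boot all_order all_algebra.
From mathcomp Require Import all_classical all_reals all_analysis.
From mathcomp Require Import measurable_realfun ring lra.
Set Implicit Arguments.
Unset Strict Implicit.
Unset Printing Implicit Defensive.
Import Order.TTheory GRing.Theory Num.Theory.
Import numFieldNormedType.Exports.
Local Open Scope classical_set_scope.
Local Open Scope ring_scope.

(* Let [M] be the supremum of [Phi p s] and [tau = s * erfp_inv p (1 - 1/N)], so
   that [Phi p s tau = (1 - 1/N) M].  A minimizer [xhat] of [J p s] satisfies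
   [J xhat <= J x <= k M], while each entry above [tau] contributes more than
   [(1 - 1/N) M]; as there are at most [N] such entries, there are at most [k].
   Hence [v = xhat - x], which lies in [Ker A], has at most [2 k] entries above
   [tau], and with [1/e = 1 - 1/q], Hoelder's inequality gives
     [Delta^(1/e) |v|_q <= |v|_1 <= (2 k)^(1/e) |v|_q + N tau],
   where [2 k <= 2^e k < Delta].  The case [tau = 0] also shows that [x] is the
   unique sparsest feasible vector. *)

Definition expp {R : realType} (p t : R) : R := expR (- (t `^ p)).

Definition expp_int {R : realType} (p x : R) : R :=
  \int[@lebesgue_measure R]_(t in `[0%R, x]) expp p t.

(** The integral over the whole half-line, equal to [Gamma p^-1 / p] when [0 < p] by [GammaV]. As a
    real supremum it is meaningful once [has_ubound_expp_int] is known. *)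
Definition expp_total {R : realType} (p : R) : R := sup (range (expp_int p)).

Section Expp.
Context {R : realType}.
Notation mu := (@lebesgue_measure R).
Implicit Types p s t x y : R.

Lemma expp_gt0 p t : 0 < expp p t.
Proof. exact: expR_gt0. Qed.

Lemma expp_le1 p t : expp p t <= 1.
Proof. by rewrite -[leRHS]expR0 ler_expR oppr_le0 powR_ge0. Qed.

Lemma expp_nonincreasing p x y : 0 < p -> 0 <= x -> x <= y ->
  expp p y <= expp p x.
Proof.
move=> p0 x0 xy; rewrite ler_expR lerN2.
by apply: ge0_ler_powR => //; [exact: ltW|rewrite nnegrE (le_trans x0)].
Qed.

Lemma measurable_expp p (D : set R) : measurable_fun D (expp p).
Proof.
apply: (@measurable_funTS _ _ (measurableTypeR R) (measurableTypeR R)).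
by apply: measurableT_comp => //; exact: measurableT_comp.
Qed.

Lemma integrable_expp p x y : mu.-integrable `[x, y] (EFin \o expp p).
Proof.
apply: measurable_bounded_integrable => //.
- exact: (compact_finite_measure (@segment_compact _ x y)).
- exact: measurable_expp.
- exists 1; split => // M M1 t _ /=.
  by rewrite ger0_norm ?ltW ?expp_gt0// (le_lt_trans (expp_le1 _ _)).
Qed.

Lemma continuous_expp p x : 0 < x -> {for x, continuous (expp p)}.
Proof.
move=> x0; apply: differentiable_continuous; apply/derivable1_diffP.
apply: diff_derivable; apply: differentiable_comp; last exact/derivable1_diffP.
apply: differentiableN; apply/derivable1_diffP.
by apply: derivable_powR; rewrite in_itv/= andbT.
Qed.

Lemma expp_cvg0 p : 0 < p -> expp p x @[x --> 0^'+] --> expp p 0.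
Proof.
move=> p0; apply: (@cvg_comp _ _ _ (fun x : R => - (x `^ p)) expR);
  last exact: continuous_expR.
by apply: cvgN; rewrite powR0 ?gt_eqF//; exact: powR_cvg0.
Qed.

Lemma within_continuous_expp p x : 0 < p -> 0 < x ->
  {within `[0, x], continuous (expp p)}.
Proof.
move=> p0 x0; apply/continuous_within_itvP => //; split.
- by move=> t /[!in_itv]/= /andP[t0 _]; exact: continuous_expp.
- exact: expp_cvg0.
- exact/cvg_at_left_filter/continuous_expp.
Qed.

Lemma expp_int0 p : expp_int p 0 = 0.
Proof. by rewrite /expp_int set_itv1 Rintegral_set1. Qed.

Lemma expp_int_lt0 p x : x < 0 -> expp_int p x = 0.
Proof.
by move=> x0; rewrite /expp_int set_itv_ge ?Rintegral_set0// bnd_simp -ltNge.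
Qed.

(** The integrand is nonincreasing, so its endpoint values bound it on [[x, y]]. The lower bound
    yields strict monotonicity; the upper one yields boundedness and the behaviour near 0. *)
Lemma expp_intB p x y : 0 < p -> 0 <= x -> x <= y ->
  (y - x) * expp p y <= expp_int p y - expp_int p x <= (y - x) * expp p x.
Proof.
move=> p0 x0 xy; rewrite Rintegral_itvB//; last exact: integrable_expp.
rewrite Rintegral_itv_obnd_cbnd; last first.
  by apply: integrableS (integrable_expp p x y) => //; exact: subset_itv_oc_cc.
have muxy : fine (mu `[x, y]) = y - x.
  rewrite (lebesgue_measure_itv `[x, y])/= lte_fin; case: ltP => //= yx.
  by apply/esym/eqP; rewrite subr_eq0 eq_le xy yx.
have cstI c : mu.-integrable `[x, y] (EFin \o cst c).
  apply: measurable_bounded_integrable => //.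
    exact: (compact_finite_measure (@segment_compact _ x y)).
  exact: (@bounded_cst R R^o).
rewrite -muxy ![fine _ * _]mulrC -!Rintegral_cst//; apply/andP; split.
- apply: le_Rintegral => //; [exact: cstI|exact: integrable_expp|].
  move=> t /=; rewrite in_itv/= => /andP[xt ty].
  by rewrite expp_nonincreasing// (le_trans x0).
- apply: le_Rintegral => //; [exact: integrable_expp|exact: cstI|].
  by move=> t /=; rewrite in_itv/= => /andP[xt ty]; exact: expp_nonincreasing.
Qed.

Lemma expp_int_ge0 p x : 0 <= expp_int p x.
Proof. by apply: Rintegral_ge0 => t _; rewrite ltW ?expp_gt0. Qed.

Lemma expp_int_increasing p x y : 0 < p -> 0 <= x -> x < y ->
  expp_int p x < expp_int p y.
Proof.
move=> p0 x0 xy; have /andP[+ _] := expp_intB p0 x0 (ltW xy).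
by rewrite -subr_gt0; apply: lt_le_trans; rewrite mulr_gt0 ?subr_gt0 ?expp_gt0.
Qed.

Lemma expp_int_nondecreasing p : 0 < p -> nondecreasing_fun (expp_int p).
Proof.
move=> p0 x y xy; have [x0|x0] := ltP x 0.
  by rewrite expp_int_lt0// expp_int_ge0.
move: xy; rewrite le_eqVlt => /predU1P[->//|xy].
exact/ltW/expp_int_increasing.
Qed.

(* From [t^p = exp(p ln t) >= (1 + a ln t)^2 >= a^2 (ln t)^2] with [a = p / 2],
   and [a^2 (ln t)^2 + a^-2 >= 2 ln t]. *)
Lemma expp_le_inv_sqr p t : 0 < p -> 1 <= t ->
  expp p t <= expR ((p / 2) ^- 2) / t ^+ 2.
Proof.
move=> p0 t1; have t0 : 0 < t by rewrite (lt_le_trans _ t1).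
set a := p / 2; have a0 : 0 < a by rewrite divr_gt0.
have L0 : 0 <= ln t by rewrite ln_ge0.
have -> : t ^+ 2 = expR (2 * ln t) by rewrite expRM_natl lnK.
rewrite -expRB ler_expR.
have -> : t `^ p = expR (a * ln t) ^+ 2.
  by rewrite /powR gt_eqF// -expRM_natl /a; congr expR; lra.
have aL : (a * ln t) ^+ 2 <= expR (a * ln t) ^+ 2.
  have aL0 : 0 <= a * ln t by apply: mulr_ge0 => //; exact: ltW.
  apply: lerXn2r; rewrite ?nnegrE ?expR_ge0//.
  by rewrite (le_trans _ (expR_ge1Dx _))// lerDr.
have : 0 <= (a * ln t - a^-1) ^+ 2 by rewrite sqr_ge0.
have -> : (a * ln t - a^-1) ^+ 2 = (a * ln t) ^+ 2 - 2 * ln t + a ^- 2.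
  by field; rewrite gt_eqF.
lra.
Qed.

(** Dyadic summation: [[0, 1]] contributes at most 1, and by the inverse-square decay the blocks
    between consecutive powers of 2 add up to at most [2 * K]. *)
Lemma expp_int_le p x : 0 < p ->
  expp_int p x <= 1 + 2 * expR ((p / 2) ^- 2).
Proof.
move=> p0; set K := expR _.
have K0 : 0 < K by exact: expR_gt0.
have dyadic n : expp_int p (2 ^+ n) <= 1 + 2 * K - 2 * K / 2 ^+ n.
  elim: n => [|n IHn].
    have /andP[_] := expp_intB p0 (lexx 0) (@ler01 R).
    rewrite expp_int0 !subr0 !expr0 mul1r => I1.
    by have := expp_le1 p 0; lra.
  have p2 : 1 <= 2 ^+ n :> R by rewrite exprn_ege1// ler1n.
  have p20 : 0 < 2 ^+ n :> R by rewrite exprn_gt0.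
  have /andP[_] : (2 ^+ n.+1 - 2 ^+ n) * expp p (2 ^+ n.+1) <=
      expp_int p (2 ^+ n.+1) - expp_int p (2 ^+ n) <=
      (2 ^+ n.+1 - 2 ^+ n) * expp p (2 ^+ n).
    by apply: expp_intB => //; rewrite ?exprn_ge0// ler_eXn2l// ltr1n.
  have -> : 2 ^+ n.+1 - 2 ^+ n = 2 ^+ n :> R by rewrite exprS; lra.
  have := expp_le_inv_sqr p0 p2; rewrite -/K => fK I2.
  have : 2 ^+ n * expp p (2 ^+ n) <= K / 2 ^+ n.
    apply: le_trans (ler_wpM2l (ltW p20) fK) _.
    by rewrite le_eqVlt; apply/orP; left; apply/eqP; field; rewrite gt_eqF.
  have -> : 2 * K / 2 ^+ n.+1 = K / 2 ^+ n.
    by rewrite exprS; field; rewrite gt_eqF.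
  have : 2 * K / 2 ^+ n = 2 * (K / 2 ^+ n) by rewrite mulrA.
  lra.
have xn : x <= 2 ^+ Num.bound x by rewrite ltW// upper_nthrootP.
apply: le_trans (expp_int_nondecreasing p0 xn) _.
apply: le_trans (dyadic _) _.
by rewrite gerBl divr_ge0 ?exprn_ge0// mulr_ge0 ?ltW.
Qed.

Lemma has_ubound_expp_int p : 0 < p -> has_ubound (range (expp_int p)).
Proof.
move=> p0; exists (1 + 2 * expR ((p / 2) ^- 2)) => _ [x _ <-].
exact: expp_int_le.
Qed.

Lemma expp_int_le_total p x : 0 < p -> expp_int p x <= expp_total p.
Proof. by move=> p0; apply: ub_le_sup; [exact: has_ubound_expp_int|exists x]. Qed.

Lemma expp_int_lt_total p x : 0 < p -> 0 <= x -> expp_int p x < expp_total p.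
Proof.
move=> p0 x0; apply: lt_le_trans (expp_int_le_total (x + 1) p0).
by apply: expp_int_increasing => //; rewrite ltrDl.
Qed.

Lemma expp_total_gt0 p : 0 < p -> 0 < expp_total p.
Proof. by move=> p0; rewrite -(expp_int0 p) expp_int_lt_total. Qed.

Lemma within_continuous_expp_int p b : 0 <= b ->
  {within `[0, b], continuous (expp_int p)}.
Proof.
move=> b0; apply: parameterized_integral_continuous => //.
exact: integrable_expp.
Qed.

(** A value below the supremum is exceeded at some [b], and the intermediate value theorem applies
    on [[0, b]]. *)
Lemma expp_int_surj p v : 0 < p -> 0 <= v -> v < expp_total p ->
  exists2 c, 0 <= c & expp_int p c = v.
Proof.
move=> p0 v0 vM.
have [_ [b _ <-] vb] : exists2 y, range (expp_int p) y & v < y.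
  by apply: sup_gt => //; exists (expp_int p 0), 0.
have b0 : 0 <= b.
  rewrite leNgt; apply/negP => b0; move: vb.
  by rewrite expp_int_lt0// ltNge v0.
have [||c] := @IVT R (expp_int p) 0 b v b0; first exact: within_continuous_expp_int.
  by rewrite expp_int0 ge_min v0/= le_max (ltW vb) orbT.
by rewrite in_itv/= => /andP[c0 _] cv; exists c.
Qed.

Lemma is_derive_expp_int p x : 0 < x -> is_derive x 1 (expp_int p) (expp p x).
Proof.
move=> x0; have xx1 : x < x + 1 by rewrite ltrDl.
have [dI <-] := @continuous_FTC1_closed R (expp p) 0 x (x + 1) xx1
  (integrable_expp p 0 _) x0 (continuous_expp x0).
by rewrite derive1E; exact: derivableP.
Qed.

(* Unlike in [ge0_continuous_FTC2y], [f] may be unbounded near [0]. *)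
Lemma integral_oy_FTC2 (f F : R -> R) (l : R) :
  {in `]0, +oo[, forall x, 0 <= f x} ->
  {in `]0, +oo[, continuous f} ->
  {in `]0, +oo[, forall x, is_derive x 1 F (f x)} ->
  F x @[x --> 0^'+] --> 0 -> F x @[x --> +oo] --> l ->
  (\int[mu]_(t in `]0%R, +oo[) (f t)%:E = l%:E)%E.
Proof.
move=> f0 cf dF F0 Fl.
pose E n : set R := `[n.+1%:R^-1, +oo[%classic.
(* The sets [E n] exhaust the open half-line while staying away from 0. The integrals over them have
   two limits to compare: one by monotone convergence, one from the antiderivative, since [F] tends
   to 0 at 0. *)
have n0 n : 0 < n.+1%:R^-1 :> R by rewrite invr_gt0.
have sub0 n x : n.+1%:R^-1 <= x -> x \in `]0, +oo[.
  by move=> nx; rewrite in_itv/= andbT (lt_le_trans _ nx).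
have -> : `]0, +oo[%classic = \bigcup_n E n.
  by rewrite itvoyEbigcup; apply: eq_bigcup => // n _; rewrite add0r.
have intE n : (\int[mu]_(t in E n) (f t)%:E = l%:E - (F n.+1%:R^-1)%:E)%E.
  apply: ge0_continuous_FTC2y => //.
  - by move=> x /sub0; exact: f0.
  - apply/continuous_within_itvcyP; split.
      move=> x; rewrite in_itv/= andbT => /ltW/sub0; exact: cf.
    exact/cvg_at_right_filter/cf/(sub0 n).
  - by move=> x /ltW/sub0/dF.
  - apply: cvg_at_right_filter; apply: differentiable_continuous.
    by apply/derivable1_diffP; have /dF[] := sub0 n _ (lexx _).
  - move=> x; rewrite in_itv/= andbT => /ltW/sub0/dF xF.
    by rewrite derive1E derive_val.
have lim1 : (\int[mu]_(t in E n) (f t)%:E)%E @[n --> \oo] -->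
    (\int[mu]_(t in \bigcup_n E n) (f t)%:E)%E.
  apply: ge0_nondecreasing_set_cvg_integral => //.
  - move=> i j ij; apply/subsetPset; apply: subset_itvr.
    by rewrite bnd_simp lef_pV2 ?posrE// ler_nat.
  - by move=> i; exact: measurable_itv.
  - move=> n; apply/measurable_EFinP.
    apply: (@measurable_funS _ _ _ _ (`]0, +oo[%classic : set R)) => //.
      by move=> x; rewrite /E/= !in_itv/= !andbT; exact: lt_le_trans.
    apply: open_continuous_measurable_fun => //.
    by apply/in_continuous_mksetP.
  - by move=> n x; rewrite /E/= in_itv/= andbT lee_fin => /sub0/f0.
have lim2 : (\int[mu]_(t in E n) (f t)%:E)%E @[n --> \oo] --> l%:E.
  under eq_fun do rewrite intE -EFinB.
  apply: cvg_EFin; first exact: nearW.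
  rewrite -[l in X in _ --> X]subr0; apply: cvgB; first exact: cvg_cst.
  move/cvg_at_rightP : F0; apply; split => //; exact: cvg_harmonic.
exact: cvg_unique lim1 lim2.
Qed.

End Expp.

(** * The generalized error function, its inverse, and the scaling of [Phi] *)

Section Erfp.
Context {R : realType}.
Notation mu := (@lebesgue_measure R).
Implicit Types p s t x y : R.

Lemma powR_cvgy p : 0 < p -> (x : R) `^ p @[x --> +oo] --> +oo.
Proof.
move=> p0; apply/cvgryPge => M; near=> x.
have x0 : 0 < x by near: x; exact: nbhs_pinfty_gt.
have -> : M = p * (M / p) by field; rewrite gt_eqF.
rewrite /powR gt_eqF// (le_trans _ (expR_ge1Dx _))// ler_wpDl// ler_pM2l//.
rewrite -ler_expR lnK//.
Unshelve. all: by end_near. Qed.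

(* The substitution [u = t `^ p] turns the Gamma integral into that of [expp p]. *)
Lemma GammaV p : 0 < p -> Gamma p^-1 = p * expp_total p.
Proof.
move=> p0; have V0 : 0 < p^-1 by rewrite invr_gt0.
pose F x := p * expp_int p (x `^ p^-1).
rewrite /Gamma /Rintegral (@integral_oy_FTC2 _ _ F (p * expp_total p))//.
- by move=> x _; rewrite mulr_ge0 ?powR_ge0 ?expR_ge0.
- move=> x; rewrite in_itv/= andbT => x0.
  apply: differentiable_continuous; apply/derivable1_diffP.
  apply: derivableM; first by apply: derivable_powR; rewrite in_itv/= andbT.
  by apply: diff_derivable; apply: differentiable_comp;
    [exact: differentiableN|exact/derivable1_diffP].
- move=> x; rewrite in_itv/= andbT => x0.
  have xV0 : 0 < x `^ p^-1 by exact: powR_gt0.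
  have dI := is_derive_expp_int p xV0.
  have dP := is_derive1_powR p^-1 x0.
  have dF := is_deriveZ p (@is_derive1_comp R _ (fun y => y `^ p^-1) x _ _ dI dP).
  apply: is_derive_eq dF _; rewrite /GRing.scale/= /expp -powRrM mulVf ?gt_eqF//.
  by rewrite powRr1 ?(ltW x0)//; field; rewrite gt_eqF.
- apply: (@squeeze_cvgr _ _ _ _ (cst 0) (fun x => p * x `^ p^-1)).
  + near=> x; have x0 : 0 <= x by near: x; exact: nbhs_right_ge.
    rewrite mulr_ge0 ?expp_int_ge0 ?(ltW p0)//= ler_pM2l//.
    have /andP[_] := expp_intB p0 (lexx 0) (powR_ge0 x p^-1).
    rewrite expp_int0 !subr0 => /le_trans; apply.
    by rewrite ler_piMr ?powR_ge0// expp_le1.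
  + exact: cvg_cst.
  + by rewrite -[X in _ --> X](mulr0 p); apply: cvgMr; exact: powR_cvg0.
- apply: cvgMr; apply: cvg_comp (powR_cvgy V0) _.
  apply: nondecreasing_cvgr; [exact: expp_int_nondecreasing|].
  exact: has_ubound_expp_int.
Unshelve. all: by end_near. Qed.

Lemma erfpE p x : 0 < p -> erfp p x = expp_int p x / expp_total p.
Proof.
move=> p0; rewrite /erfp GammaV// -/(expp_int p x).
by field; rewrite !gt_eqF// expp_total_gt0.
Qed.

(** This makes the partial inverse [erfp_inv p] a true right inverse on [[0, 1[], with values in
    [[0, +oo[]. *)
Lemma erfp_surj p : 0 < p -> set_surj `[0, +oo[ `[0, 1[ (erfp p).
Proof.
move=> p0 v /=; rewrite in_itv/= => /andP[v0 v1].
have M0 := expp_total_gt0 p0.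
have [||c c0 cv] := @expp_int_surj _ p (v * expp_total p) p0.
- by rewrite mulr_ge0// ltW.
- by rewrite gtr_pMl.
exists c; first by rewrite /= in_itv/= c0.
by rewrite erfpE// cv mulfK// gt_eqF.
Qed.

Lemma erfp_invK p v : 0 < p -> 0 <= v < 1 -> erfp p (erfp_inv p v) = v.
Proof.
by move=> p0 v01; apply: (surjpK _ (erfp_surj p0)); rewrite inE/= in_itv.
Qed.

Lemma erfp_inv_ge0 p v : 0 < p -> 0 <= v < 1 -> 0 <= erfp_inv p v.
Proof.
move=> p0 v01.
have /= := surjpinv_image_sub (dflt := fun=> 0) (erfp_surj p0).
move=> /(_ (erfp_inv p v)) /=; rewrite in_itv/= andbT; apply.
by exists v; rewrite //= in_itv.
Qed.

(** Substitution [u = t / s]. It separates the scale [s] from the shape [p], so that every fact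
    about [expp_int] transfers to [Phi]. *)
Lemma PhiE p s x : 0 < p -> 0 < s -> 0 <= x ->
  Phi p s x = s * expp_int p (x / s).
Proof.
(* The point [x = 0] is settled apart, as [within_continuous_expp] asks for a nondegenerate
   interval. *)
move=> p0 s0; rewrite le_eqVlt => /predU1P[<-|x0].
  by rewrite mul0r expp_int0 mulr0 /Phi set_itv1 Rintegral_set1.
have xs0 : 0 < x / s by rewrite divr_gt0.
have dF t : is_derive t 1 (fun t : R => t / s) s^-1.
  have -> : (fun t : R => t / s) = s^-1 \*: id.
    by apply/funext => u /=; rewrite mulrC.
  by apply: is_derive_eq; rewrite /GRing.scale/= mulr1.
have F' : derive1 (fun t : R => t / s) = cst s^-1.
  by apply/funext => t; rewrite derive1E derive_val.
have cF t : {for t, continuous (fun t : R => t / s)}.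
  by apply: differentiable_continuous; apply/derivable1_diffP.
have := @integration_by_substitution_increasing R (fun t => t / s) (expp p)
  0 x (ltW x0).
rewrite mul0r F' => sub.
rewrite /expp_int /Rintegral sub; first last.
- exact: within_continuous_expp.
- split; first by move=> t _; exact: ex_derive.
    exact/cvg_at_right_filter/cF.
  exact/cvg_at_left_filter/cF.
- exact: is_cvg_cst.
- exact: is_cvg_cst.
- by move=> t _; exact: cst_continuous.
- by move=> t u _ _ tu; rewrite ltr_pM2r ?invr_gt0.
have gI : mu.-integrable `[0, x] (EFin \o (fun t => expp p (t / s))).
  apply: measurable_bounded_integrable => //.
  - exact: (compact_finite_measure (@segment_compact _ 0 x)).
  - apply: (@measurable_funTS _ _ (measurableTypeR R) (measurableTypeR R)).
    apply: measurableT_comp; first exact: measurable_expp.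
    exact: measurable_funM.
  - exists 1; split => // M M1 t _ /=.
    by rewrite ger0_norm ?ltW ?expp_gt0// (le_lt_trans (expp_le1 _ _)).
rewrite -[fine _]/(\int[mu]_(t in `[0, x]) (expp p (t / s) * s^-1)).
by rewrite RintegralZr// mulrC mulfVK// gt_eqF.
Qed.

End Erfp.

(** * The norms [lqnorm] and the spherical section constant *)

Section Norms.
Context {R : realType}.
Implicit Types (q : \bar R) (m N n : nat).

Lemma exp_1mqE q : exp_1mq q = - exp_qm1 q.
Proof.
case: q => [r| |] //=; last by rewrite oppr0.
by rewrite -(opprB r 1) invrN mulrN.
Qed.

Lemma exp_qm1_ge1 q : (1%:E < q)%E -> 1 <= exp_qm1 q.
Proof.
case: q => [r| |]//=; rewrite lte_fin => r1.
by rewrite ler_pdivlMr ?subr_gt0// mul1r gerBl.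
Qed.

Lemma lqnorm_ge0 q N (v : 'cV[R]_N) : 0 <= lqnorm q v.
Proof.
case: q => [r| |] //=; first exact: powR_ge0.
by apply: (big_ind (fun y : R => 0 <= y)) => // a b a0 b0; rewrite le_max a0.
Qed.

Lemma lqnorm1E N (v : 'cV[R]_N) : lqnorm 1%:E v = \sum_(j < N) `|v j 0|.
Proof.
rewrite /= invr1 powRr1; last by apply: sumr_ge0 => j _; exact: powR_ge0.
by apply: eq_bigr => j _; rewrite powRr1.
Qed.

Lemma lqnorm_eq0 q N (v : 'cV[R]_N) : (1%:E < q)%E -> lqnorm q v = 0 -> v = 0.
Proof.
case: q => [r| |]//= q1 v0; apply/colP => j; rewrite mxE; apply/normr0_eq0.
- move/powR_eq0_eq0 : v0 => /psumr_eq0P v0.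
  by apply: (@powR_eq0_eq0 _ _ r); apply: v0 => // i _; exact: powR_ge0.
- by apply/le_anti; rewrite normr_ge0 andbT -v0; exact: le_bigmax.
Qed.

Lemma lqnorm0 q N : (1%:E < q)%E -> lqnorm q (0 : 'cV[R]_N) = 0.
Proof.
move=> q1; apply/le_anti; rewrite lqnorm_ge0 andbT.
case: q q1 => [r| |]//= q1; last by apply: bigmax_le => // j _; rewrite mxE normr0.
  have r0 : r != 0 by rewrite gt_eqF//; move: q1; rewrite lte_fin; exact: lt_trans.
rewrite big1 ?powR0 ?invr_eq0// => j _.
by rewrite mxE normr0 powR0.
Qed.

(** Hoelder's inequality against the indicator of [T]; the inverse of [exp_qm1 q] is [1 - 1/q]. *)
Lemma sum_le_lqnorm q N (v : 'cV[R]_N) (T : {set 'I_N}) : (1%:E < q)%E ->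
  \sum_(j in T) `|v j 0| <= #|T|%:R `^ (exp_qm1 q)^-1 * lqnorm q v.
Proof.
move=> q1; case: q q1 => [r| |]// q1; last first.
  rewrite invr1 powRr1// mulr_natl -sumr_const; apply: ler_sum => j _ /=.
  exact: le_bigmax.
have [->|T0] := eqVneq T finset.set0.
  by rewrite finset.big_set0 mulr_ge0 ?powR_ge0 ?lqnorm_ge0.
have [L0|L0] := eqVneq (lqnorm r%:E v) 0.
  rewrite L0 mulr0 (lqnorm_eq0 q1 L0) big1// => j _.
  by rewrite mxE normr0.
have {}L0 : 0 < lqnorm r%:E v by rewrite lt_def L0 lqnorm_ge0.
set L := lqnorm r%:E v in L0 *; set e := exp_qm1 r%:E.
have e0 : 0 < e by rewrite (lt_le_trans _ (exp_qm1_ge1 q1)).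
move: q1; rewrite lte_fin => r1; have r0 : 0 < r by rewrite (lt_trans _ r1).
have re : r^-1 + e^-1 = 1.
  by rewrite /e /=; field; rewrite subr_eq0 !gt_eqF.
have n0 : 0 < #|T|%:R :> R by rewrite ltr0n card_gt0.
set n : R := #|T|%:R in n0 *.
have Lr0 : 0 < L `^ r by exact: powR_gt0.
have Lr : L `^ r = \sum_(j < N) `|v j 0| `^ r.
  rewrite /L /= -powRrM mulVf ?gt_eqF// powRr1//.
  by apply: sumr_ge0 => j _; exact: powR_ge0.
have : \sum_(j in T) (`|v j 0| / L) * n `^ (- e^-1) <= 1.
  apply: (@le_trans _ _ (\sum_(j in T)
     (`|v j 0| `^ r / L `^ r / r + n^-1 / e))).
    apply: ler_sum => j _.
    apply: le_trans (conjugate_powR _ _ r0 e0 re) _.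
    - by rewrite divr_ge0// ltW.
    - exact: powR_ge0.
    rewrite powRM ?invr_ge0 ?(ltW L0)// -powRrM mulNr mulVf ?gt_eqF//.
    rewrite powR_inv1 ?(ltW n0)//.
    by rewrite -(powR_inv1 (ltW L0)) powRAC powR_inv1// powR_ge0.
  rewrite big_split/= -!mulr_suml sumr_const -[_ *+ _]mulr_natr -/n.
  rewrite mulrAC mulVf ?gt_eqF// mul1r -re.
  rewrite lerD2r mulrAC ler_piMl ?invr_ge0 ?(ltW r0)//.
  rewrite ler_pdivrMr//.
  rewrite mul1r Lr.
  rewrite [leRHS](bigID (mem T))/= lerDl.
  by apply: sumr_ge0 => j _; exact: powR_ge0.
rewrite -!mulr_suml powRN ler_pdivrMr ?powR_gt0// mul1r.
by rewrite ler_pdivrMr.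
Qed.

Lemma powRV_le (a b e : R) : 0 < e -> 0 <= a -> 0 <= b -> a <= b `^ e ->
  a `^ e^-1 <= b.
Proof.
move=> e0 a0 b0 abe; rewrite -[leRHS](powRr1 b0) -(mulfV (lt0r_neq0 e0)) powRrM.
apply: ge0_ler_powR; rewrite ?nnegrE ?invr_ge0//; first exact: ltW.
exact: powR_ge0.
Qed.

Lemma sph_const_le q m N (A : 'M[R]_(m, N)) (v : 'cV[R]_N) :
  Ker A v -> v != 0 ->
  0 <= sph_const q A <= (lqnorm 1%:E v / lqnorm q v) `^ exp_qm1 q.
Proof.
move=> Av v0; apply/andP; split.
  apply: lb_le_inf.
    exists ((lqnorm 1%:E v / lqnorm q v) `^ exp_qm1 q), v => //.
    by split => //= /eqP; rewrite (negbTE v0).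
  by move=> _ [w _ <-]; exact: powR_ge0.
apply: ge_inf.
  by exists 0 => _ [w _ <-]; exact: powR_ge0.
by exists v => //; split => //= /eqP; rewrite (negbTE v0).
Qed.

(** The spherical section constant bounds the l1 norm of [v] from below. From above, the entries in
    [T] are controlled by Hoelder and the at most [N] others by [tau] each. It serves both
    uniqueness ([tau = 0]) and the error estimate. *)
Lemma Ker_lqnorm_le q m N (A : 'M[R]_(m, N)) (v : 'cV[R]_N) (T : {set 'I_N})
    n (tau : R) : (1%:E < q)%E -> Ker A v -> (#|T| <= n)%N ->
  0 <= tau -> (forall j, j \notin T -> `|v j 0| <= tau) ->
  (sph_const q A `^ (exp_qm1 q)^-1 - n%:R `^ (exp_qm1 q)^-1) * lqnorm q v
    <= N%:R * tau.
Proof.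
move=> q1 Av Tn tau0 vT; set e := exp_qm1 q.
have e0 : 0 < e by rewrite (lt_le_trans _ (exp_qm1_ge1 q1)).
have [->|v0] := eqVneq v 0; first by rewrite lqnorm0// mulr0 mulr_ge0.
have L0 : 0 < lqnorm q v.
  rewrite lt_def lqnorm_ge0 andbT; apply: contra v0 => /eqP v0.
  by rewrite (lqnorm_eq0 q1 v0).
have /andP[D0 Dv] := sph_const_le q Av v0.
have DL : sph_const q A `^ e^-1 * lqnorm q v <= \sum_(j < N) `|v j 0|.
  rewrite -lqnorm1E -ler_pdivlMr//.
  by apply: powRV_le => //; rewrite divr_ge0 ?lqnorm_ge0.
rewrite mulrBl lerBlDr (le_trans DL)// (bigID (mem T))/= addrC; apply: lerD.
  apply: (@le_trans _ _ (\sum_(j | j \notin T) tau)); first exact: ler_sum.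
  rewrite sumr_const mulr_natl; apply: ler_wpMn2l => //.
  by rewrite (leq_trans (max_card _))// card_ord.
apply: le_trans (sum_le_lqnorm v T q1) _; rewrite ler_pM2r//.
by apply: ge0_ler_powR; rewrite ?nnegrE ?invr_ge0 ?(ltW e0)// ler_nat.
Qed.

End Norms.

(** * Counting the large entries of a minimizer, and recovery of [x] *)

Section Recovery.
Context {R : realType}.
Implicit Types (q : \bar R) (m N : nat).

Lemma Phi_le p s x : 0 < p -> 0 < s -> 0 <= x -> Phi p s x <= s * @expp_total R p.
Proof. by move=> p0 s0 x0; rewrite PhiE// ler_pM2l// expp_int_le_total. Qed.

(** At the threshold [s * erfp_inv p v], [Phi p s] takes exactly the fraction [v] of its supremum
    [s * expp_total p]; beyond it, strict monotonicity applies. *)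
Lemma Phi_erfp_inv_gt p s v x : 0 < p -> 0 < s -> 0 <= v < 1 ->
  s * erfp_inv p v < x -> v * (s * @expp_total R p) < Phi p s x.
Proof.
move=> p0 s0 v01 sx; have v0 := erfp_inv_ge0 p0 v01.
have x0 : 0 <= x by rewrite (le_trans _ (ltW sx))// mulr_ge0// ltW.
rewrite PhiE// mulrCA ltr_pM2l//.
have M0 := expp_total_gt0 p0.
rewrite -[v in v * _](erfp_invK p0 v01) erfpE// divfK ?gt_eqF//.
by apply: expp_int_increasing => //; rewrite ltr_pdivlMr// mulrC.
Qed.

Lemma J_le p s N (x : 'cV[R]_N) : 0 < p -> 0 < s ->
  J p s x <= (l0norm x)%:R * (s * expp_total p).
Proof.
move=> p0 s0; rewrite mulr_natl -sumr_const /J.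
rewrite (bigID (mem [set j | x j 0 != 0]%SET))/= -[leRHS]addr0; apply: lerD.
  by apply: ler_sum => j _; exact: Phi_le.
rewrite big1// => j; rewrite inE negbK => /eqP ->.
by rewrite normr0 PhiE// mul0r expp_int0 mulr0.
Qed.

(** Places [1 - 1/N] in the domain of [erfp_inv]; the value 0 occurs for [N = 1]. *)
Lemma onem_natV_itv n : (0 < n)%N -> 0 <= 1 - (n%:R : R)^-1 < 1.
Proof.
move=> n0; have nR0 : 0 < n%:R :> R by rewrite ltr0n.
by rewrite subr_ge0 invf_le1// ler1n n0 gtrBl invr_gt0.
Qed.

Lemma card_minimizer_gt m N (A : 'M[R]_(m, N)) (x xhat : 'cV[R]_N) (p s : R) :
  (0 < N)%N -> 0 < p -> 0 < s -> is_minimizer A (A *m x) (@J R p s N) xhat ->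
  (#|[set j | (s * erfp_inv p (1 - N%:R^-1) < `|xhat j 0|)%R]%SET| <= l0norm x)%N.
Proof.
move=> N0 p0 s0 [_ /(_ x erefl)].
move=> Jle.
set v := 1 - N%:R^-1; set T := [set j | _]%SET; set M := s * expp_total p.
have NR0 : 0 < N%:R :> R by rewrite ltr0n.
have v01 : 0 <= v < 1 := onem_natV_itv N0.
have M0 : 0 < M by rewrite mulr_gt0// expp_total_gt0.
(* A strict inequality between sums over [T] requires a nonempty [T]. *)
have [->//|T0] := posnP #|T|.
have TM : #|T|%:R * (v * M) < (l0norm x)%:R * M.
  apply: lt_le_trans (J_le x p0 s0).
  apply: lt_le_trans Jle; rewrite mulr_natl -sumr_const.
  apply: (@lt_le_trans _ _ (\sum_(j in T) Phi p s `|xhat j 0|)).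
    apply: ltr_sum.
      have /card_gt0P[j jT] := T0.
      by apply/hasP; exists j => //; rewrite mem_index_enum.
    by move=> j; rewrite inE; exact: Phi_erfp_inv_gt.
  rewrite /J [leRHS](bigID (mem T))/= lerDl; apply: sumr_ge0 => j _.
  by rewrite PhiE// mulr_ge0 ?expp_int_ge0// ltW.
have : #|T|%:R - #|T|%:R / N%:R < (l0norm x)%:R :> R.
  by move: TM; rewrite mulrA ltr_pM2r// mulrBr mulr1.
have : #|T|%:R / N%:R <= 1 :> R.
  by rewrite ler_pdivrMr// mul1r ler_nat (leq_trans (max_card _))// card_ord.
(* The loss [#|T| / N] is at most 1, so [#|T| < l0norm x + 1], which for integers is the claim. This
   is why the level is [1 - 1/N]. *)
move=> c1 c2; rewrite -ltnS -(ltr_nat R) -natr1; lra.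
Qed.

Lemma sph_const_gap q m N (A : 'M[R]_(m, N)) (k : nat) : (1%:E < q)%E ->
  k%:R < 2 `^ exp_1mq q * sph_const q A ->
  0 < sph_const q A `^ (exp_qm1 q)^-1 - (k + k)%:R `^ (exp_qm1 q)^-1.
Proof.
move=> q1; have e1 := exp_qm1_ge1 q1; have e0 := lt_le_trans ltr01 e1.
rewrite exp_1mqE powRN mulrC ltr_pdivlMr ?powR_gt0// => kD.
have kkD : (k + k)%:R < sph_const q A.
  apply: le_lt_trans kD; rewrite addnn -muln2 natrM.
  by apply: ler_wpM2l => //; rewrite le1r_powR// ler1n.
rewrite subr_gt0; apply: gt0_ltr_powR; rewrite ?invr_gt0// ?nnegrE//.
by rewrite (le_trans _ (ltW kkD)).
Qed.

Lemma Ker_subr m N (A : 'M[R]_(m, N)) (x z : 'cV[R]_N) :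
  A *m z = A *m x -> Ker A (z - x).
Proof. by move=> zx; rewrite /Ker/= mulmxBr zx subrr. Qed.

Lemma card_setU_supp N (x : 'cV[R]_N) (T : {set 'I_N}) k :
  l0norm x = k -> (#|T| <= k)%N ->
  (#|(T :|: [set j | (x j 0 != 0)%R])%SET| <= k + k)%N.
Proof.
move=> xk Tk; apply: leq_trans (leq_card_setU _ _) _.
by rewrite leq_add// -xk.
Qed.

(** Outside the union of the two supports, which has at most [k + k] elements, [z - x] vanishes;
    [Ker_lqnorm_le] with [tau = 0] then forces its norm to be 0. *)
Lemma l0norm_le_unique q m N (A : 'M[R]_(m, N)) (x z : 'cV[R]_N) (k : nat) :
  (1%:E < q)%E -> l0norm x = k -> k%:R < 2 `^ exp_1mq q * sph_const q A ->
  A *m z = A *m x -> (l0norm z <= k)%N -> z = x.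
Proof.
move=> q1 xk hk zx zk; apply/eqP; rewrite -subr_eq0; apply/eqP.
apply: (lqnorm_eq0 q1); apply/le_anti; rewrite lqnorm_ge0 andbT.
have := Ker_lqnorm_le q1 (Ker_subr zx) (card_setU_supp xk zk) (lexx 0).
rewrite mulr0 pmulr_rle0 ?sph_const_gap//; apply => j.
rewrite !inE negb_or !negbK !mxE => /andP[/eqP -> /eqP ->].
by rewrite subrr normr0.
Qed.

(** The exceptional set joins the entries of [xhat] above the threshold to the support of [x];
    elsewhere [xhat - x] agrees with [xhat] and is at most the threshold. *)
Lemma lqnorm_minimizer_le q m N (A : 'M[R]_(m, N)) (x xhat : 'cV[R]_N)
    (k : nat) (p s : R) :
  (1%:E < q)%E -> l0norm x = k -> (0 < N)%N -> 0 < p -> 0 < s ->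
  is_minimizer A (A *m x) (@J R p s N) xhat ->
  (sph_const q A `^ (exp_qm1 q)^-1 - (k + k)%:R `^ (exp_qm1 q)^-1)
    * lqnorm q (xhat - x) <= N%:R * (s * erfp_inv p (1 - N%:R^-1)).
Proof.
move=> q1 xk N0 p0 s0 xhatP.
have := card_minimizer_gt N0 p0 s0 xhatP; rewrite xk => Tk.
have v01 := onem_natV_itv N0.
apply: (Ker_lqnorm_le q1 (Ker_subr xhatP.1) (card_setU_supp xk Tk)).
  by rewrite mulr_ge0 ?erfp_inv_ge0// ltW.
move=> j; rewrite !inE negb_or negbK -leNgt !mxE => /andP[+ /eqP ->].
by rewrite subr0.
Qed.

End Recovery.

Theorem theorem3 (R : realType) (m N : nat) (A : 'M[R]_(m, N)) (q : \bar R)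
    (x : 'cV[R]_N) (k : nat) (hmN : (m < N)%N) (hq : (1%:E < q)%E)
    (hxk : l0norm x = k) (hk : k%:R < 2 `^ exp_1mq q * sph_const q A) :
  [/\ (* x is the unique sparsest feasible vector *)
      is_minimizer A (A *m x) (@l0norm R N) x
      /\ (forall z : 'cV[R]_N, is_minimizer A (A *m x) (@l0norm R N) z -> z = x),
      (forall eps : R, 0 < eps -> exists delta : R, 0 < delta /\
        forall p s : R, 0 < p -> 0 < s ->
          s * erfp_inv p (1 - N%:R^-1) < delta ->
          forall xhat : 'cV[R]_N, is_minimizer A (A *m x) (@J R p s N) xhat ->
            lqnorm q (xhat - x) < eps)
    & (forall p : R, 0 < p -> forall eps : R, 0 < eps ->
        \forall s \near 0^'+,
          forall xhat : 'cV[R]_N, is_minimizer A (A *m x) (@J R p s N) xhat ->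
            lqnorm q (xhat - x) < eps)].
Proof.
have N0 : (0 < N)%N by exact: leq_ltn_trans hmN.
have NR0 : 0 < N%:R :> R by rewrite ltr0n.
have c0 := sph_const_gap hq hk.
have thr eps : 0 < eps -> exists delta : R, 0 < delta /\
    forall p s : R, 0 < p -> 0 < s -> s * erfp_inv p (1 - N%:R^-1) < delta ->
    forall xhat : 'cV[R]_N, is_minimizer A (A *m x) (@J R p s N) xhat ->
      lqnorm q (xhat - x) < eps.
  move=> eps0.
  (* Chosen so that a threshold below [delta] makes [N] times it smaller than the gap times [eps];
     the positive gap is then cancelled. *)
  exists ((sph_const q A `^ (exp_qm1 q)^-1 - (k + k)%:R `^ (exp_qm1 q)^-1)
    * eps / N%:R).
  split=> [|p s p0 s0]; first by rewrite divr_gt0// mulr_gt0.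
  rewrite ltr_pdivlMr// mulrC => tau xhat xhatP.
  rewrite -(ltr_pM2l c0); apply: le_lt_trans tau.
  exact: lqnorm_minimizer_le.
split => //.
- split.
    split=> // w wx; rewrite leEnat leqNgt; apply/negP => lt_wx.
    (* A strictly sparser feasible [w] would also meet the sparsity bound, hence equal [x]. *)
    have wx' : w = x by apply: (l0norm_le_unique hq hxk hk wx); rewrite -hxk ltnW.
    by move: lt_wx; rewrite wx' ltnn.
  move=> z [zx /(_ x erefl)]; rewrite leEnat hxk.
  exact: l0norm_le_unique hk zx.
- move=> p p0 eps /thr[delta [delta0 hdelta]].
  set c := erfp_inv p (1 - N%:R^-1).
  near=> s => xhat.
  have s0 : 0 < s by near: s; exact: nbhs_right_gt.
  apply: (hdelta p s p0 s0).
  (* Adding 1 keeps the divisor positive even if [c = 0]. *)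
  have C0 : 0 < `|c| + 1 by rewrite ltr_wpDl.
  have : s < delta / (`|c| + 1) by near: s; apply: nbhs_right_lt; rewrite divr_gt0.
  rewrite ltr_pdivlMr//; apply: le_lt_trans.
  by rewrite ler_pM2l// (le_trans (ler_norm _))// lerDl.
Unshelve. all: by end_near. Qed.
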